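(* Let $X$ be a set of size $n$, and choose $M$ subsets $S_1,\dots,S_M$ of $X$ of size $k$ by uniform sampling without replacement. Let $p\le k$ and let $A$ be the event that every set of $p$ points $\{x_1,\dots,x_p\}\subseteq X$ is contained in at least one $S_i$. Then $$P(A)\ge 1-\binom{n}{p}\left(1-\left(\frac{k-p+1}{n-p+1}\right)^{p}\right)^{M}.$$
   Context: Here $1\le p\le k\le n$ and $M\geq 1$ are integers. ''Uniform sampling without replacement'' refers to the $k$ elements within each subset: the $S_i$ are independent, each uniformly distributed among all $k$-element subsets of $X$. *)

(* Defs.v *)
From HB Require Import structures.
From mathcomp Require Export all_boot all_order all_algebra.
From mathcomp Require Export all_classical all_reals all_analysis.

Set Implicit Arguments.
Unset Strict Implicit.
Unset Printing Implicit Defensive.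

Import Order.TTheory GRing.Theory Num.Theory.

Local Open Scope classical_set_scope.
Local Open Scope ring_scope.
Local Open Scope ereal_scope.

Section RandomSubsets.
Context {d : measure_display} {T : measurableType d} {R : realType}.
Variable P : probability T R.

(** A random element of a type [U] carrying the discrete sigma-algebra. *)
Definition random_element (U : Type) (S : T -> U) : Prop :=
  forall B : set U, measurable (S @^-1` B).

(** Mutual independence: the product rule holds on every subfamily [J]. *)
Definition mutually_independent (I : finType) (U : Type)
    (S : I -> T -> U) : Prop :=
  forall (J : {set I}) (B : I -> set U),
    P [set w | forall i, i \in J -> B i (S i w)]
    = \prod_(i in J) P [set w | B i (S i w)].

(** The law of [S] is uniform on the [k]-element subsets of [X]; subsets of any
    other size have probability [0], so [S] has size [k] almost surely. *)
Definition uniform_k_subset (X : finType) (k : nat) (S : T -> {set X}) : Prop :=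
  forall B : {set X},
    P [set w | S w = B]
    = (if #|B| == k then ('C(#|X|, k)%:R^-1)%:E else 0).

End RandomSubsets.

Definition covers_p_subsets (T : Type) (X : finType) (M p : nat)
    (S : 'I_M -> T -> {set X}) : set T :=
  [set w | forall Y : {set X}, #|Y| = p -> exists i : 'I_M, Y \subset S i w].

Lemma measurable_covers_p_subsets d (T : measurableType d) (X : finType)
    (M p : nat) (S : 'I_M -> T -> {set X}) :
  (forall i, random_element (S i)) -> measurable (covers_p_subsets p S).
Proof.
move=> mS.
have -> : covers_p_subsets p S =
    \big[setI/setT]_(Y : {set X} | #|Y| == p)
      \big[setU/set0]_(i : 'I_M) (S i @^-1` [set B : {set X} | Y \subset B]).
  apply/seteqP; split=> w /=.
    move=> h; elim/big_ind: _ => // Y /eqP /h [i Yi].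
    by rewrite (bigD1 i) //=; left.
  move=> h Y /eqP Yp; move: h; rewrite (bigD1 Y) //= => -[h _].
  elim/big_ind: _ h => //=.
    by move=> A B hA hB [/hA|/hB].
  by move=> i _ Yi; exists i.
by apply: bigsetI_measurable => Y _; apply: bigsetU_measurable => i _; exact: mS.
Qed.

(* Main.v *)
(** For a fixed [p]-set [Y], a uniform [k]-subset contains [Y] with probability
    ['C(n - p, k - p) / 'C(n, k)], the product of [(k - i) / (n - i)] over
    [i < p], whose smallest factor is the last one. By independence all [M]
    subsets miss [Y] with probability at most
    [(1 - ((k - p + 1) / (n - p + 1)) ^ p) ^ M]; sum this over all [Y]. *)
Require Import Defs.
From mathcomp Require Import zify ring lra.
Set Implicit Arguments.
Unset Strict Implicit.
Unset Printing Implicit Defensive.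
Import Order.TTheory GRing.Theory Num.Theory.
Local Open Scope classical_set_scope.
Local Open Scope ring_scope.

(** With [a = k - p] and [b = n - p] this is the lower bound on ['C(n - p, k - p) / 'C(n, k)] with
    denominators cleared. Shifting by [p] instead of subtracting keeps the induction on [p] free of
    truncated subtraction. *)
Lemma leq_expn_bin (a b p : nat) : (a <= b)%N ->
  (a.+1 ^ p * 'C(b + p, a + p) <= b.+1 ^ p * 'C(b, a))%N.
Proof.
move=> le_ab; elim: p => [|p IHp]; first by rewrite !addn0.
(* The extra factor [(a + p).+1] allows the absorption identity [(m + 1) 'C(N + 1, m + 1) = (N + 1)
   'C(N, m)]. *)
rewrite !addnS -(@leq_pmul2l (a + p).+1) // !expnS.
have -> : ((a + p).+1 * (a.+1 * a.+1 ^ p * 'C((b + p).+1, (a + p).+1)) =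
    (a.+1 * (b + p).+1) * (a.+1 ^ p * 'C(b + p, a + p)))%N.
  have := mul_bin_diag (b + p).+1 (a + p); rewrite /= => e.
  by rewrite mulnCA -e; ring.
have -> : ((a + p).+1 * (b.+1 * b.+1 ^ p * 'C(b, a)) =
    (b.+1 * (a + p).+1) * (b.+1 ^ p * 'C(b, a)))%N by ring.
(* The two sides of the remaining inequality differ by [(b - a) * p]. *)
by apply: leq_mul => //; nia.
Qed.

(** Adding [Y] is a bijection from the [(k - #|Y|)]-subsets of the complement of [Y] onto these
    supersets. *)
Lemma card_supset_draws (X : finType) (Y : {set X}) (k : nat) :
  (#|Y| <= k)%N ->
  #|[set B : {set X} | Y \subset B & #|B| == k]%SET| =
  'C(#|X| - #|Y|, k - #|Y|).
Proof.
move=> le_Yk; have -> : (#|X| - #|Y| = #|(~: Y)%SET|)%N.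
  by rewrite [RHS]cardsCs finset.setCK.
rewrite -cards_draws.
have -> : [set B : {set X} | Y \subset B & #|B| == k]%SET =
  (finset.setU Y @:
    [set A : {set X} | A \subset ~: Y & #|A| == (k - #|Y|)%N])%SET.
  apply/setP => B; rewrite inE; apply/andP/imsetP => [[sYB /eqP cB]|[A]].
    exists (B :\: Y)%SET; last first.
      rewrite finset.setDE finset.setUIr finset.setUCr finset.setIT.
      exact/esym/finset.setUidPr.
    by rewrite inE finset.setDE finset.subsetIr -finset.setDE cardsDS // cB /=.
  rewrite inE => /andP[sAY /eqP cA] ->; split; first exact: finset.subsetUl.
  rewrite cardsU cA; have -> : (Y :&: A = finset.set0)%SET.
    by apply/eqP; rewrite finset.setI_eq0 disjoint_sym finset.disjoints_subset.
  by rewrite cards0 subn0 subnKC.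
apply: card_in_imset => A B; rewrite !inE => /andP[sA _] /andP[sB _] eqU.
(* Injectivity: intersecting with the complement of [Y] undoes the union. *)
have K (C : {set X}) : C \subset (~: Y)%SET -> C = ((Y :|: C) :&: ~: Y)%SET.
  move=> sC; rewrite finset.setIUl finset.setICr finset.set0U.
  exact/esym/finset.setIidPl.
by rewrite (K _ sA) eqU -K.
Qed.

Section DiscreteProbability.
Context {d : measure_display} {T : measurableType d} {R : realType}.
Variable P : probability T R.

Lemma probability_random_element_in (U : finType) (S : T -> U) (A : {set U}) :
  random_element S ->
  P [set w | S w \in A] = (\sum_(u in A) P [set w | S w = u])%E.
Proof.
move=> mS.
have -> : [set w | S w \in A] = [set w | S w \in enum A].
  by apply/seteqP; split=> w /=; rewrite mem_enum.
(* Uniqueness of the enumeration is carried along because it makes the events disjoint. *)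
rewrite -big_enum /=; elim: (enum A) (enum_uniq A) => [_|u s IHs /= /andP[us us_uniq]].
  by rewrite big_nil (_ : [set _ | _] = set0) ?measure0 //;
    apply/seteqP; split.
rewrite big_cons -(IHs us_uniq) -measureU.
- by congr (P _); apply/seteqP; split=> w /=; rewrite in_cons;
    [case/orP=> [/eqP|]; [left|right] | case=> [->|->]; rewrite ?eqxx ?orbT].
- exact: (mS [set u]).
- exact: (mS [set v | v \in s]).
- by apply/seteqP; split=> w //= -[-> us']; rewrite us' in us.
Qed.

Lemma probability_bigsetU_le (I : finType) (Q : pred I) (F : I -> set T) :
  (forall i, measurable (F i)) ->
  (P (\big[setU/set0]_(i | Q i) F i) <= \sum_(i | Q i) P (F i))%E.
Proof.
move=> mF; elim: (index_enum I) => [|i s IHs]; first by rewrite !big_nil measure0.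
rewrite !big_cons; case: ifP => // _.
apply: le_trans (measureU2 _ _ _) _ => //.
  exact: bigsetU_measurable.
exact: leeD2l.
Qed.

Lemma probability_supset_uniform (X : finType) (k : nat) (S : T -> {set X})
    (Y : {set X}) :
  random_element S -> uniform_k_subset P k S -> (#|Y| <= k)%N ->
  P [set w | Y \subset S w] =
  ('C(#|X| - #|Y|, k - #|Y|)%:R / 'C(#|X|, k)%:R)%:E.
Proof.
move=> mS uS le_Yk.
have -> : [set w | Y \subset S w] =
    [set w | S w \in [set B : {set X} | Y \subset B]%SET].
  by apply/seteqP; split=> w /=; rewrite inE.
rewrite probability_random_element_in //.
under eq_bigr do rewrite uS.
(* Only supersets of size [k] contribute, all with the same mass. *)
rewrite -big_mkcondr /= sumEFin sumr_const -card_supset_draws // mulr_natl.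
by congr ((_ *+ _)%:E); apply: eq_card => B; rewrite inE unfold_in /= inE.
Qed.

End DiscreteProbability.

Lemma bin_ratio_ge (R : realType) (n k p : nat) : (p <= k)%N -> (k <= n)%N ->
  ((k%:R - p%:R + 1) / (n%:R - p%:R + 1)) ^+ p
    <= 'C(n - p, k - p)%:R / 'C(n, k)%:R :> R.
Proof.
move=> le_pk le_kn; have le_pn := leq_trans le_pk le_kn.
(* As [p <= k <= n], the differences are exact in [nat], and both denominators are positive, so
   cross-multiplication is allowed. *)
rewrite -!natrB // !natr1 expr_div_n.
rewrite ler_pdivrMr ?exprn_gt0 ?ltr0n // mulrAC ler_pdivlMr ?ltr0n ?bin_gt0 //.
rewrite -!natrX -!natrM ler_nat [leqRHS]mulnC.
by have := leq_expn_bin p (leq_sub2r p le_kn); rewrite !subnK.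
Qed.

Theorem proposition27 (R : realType) (d : measure_display)
    (T : measurableType d) (P : probability T R)
    (n k p M : nat) (X : finType) (S : 'I_M -> T -> {set X})
    (hX : #|X| = n)
    (hp : (1 <= p)%N) (hpk : (p <= k)%N) (hkn : (k <= n)%N) (hM : (1 <= M)%N)
    (hmeas : forall i : 'I_M, random_element (S i))
    (hunif : forall i : 'I_M, uniform_k_subset P k (S i))
    (hindep : mutually_independent P S) :
  ((1 - 'C(n, p)%:R *
        (1 - ((k%:R - p%:R + 1) / (n%:R - p%:R + 1)) ^+ p) ^+ M : R)%:E
   <= P (covers_p_subsets p S))%E.
Proof.
set r := (_ / _) ^+ p.
pose missed (Y : {set X}) := [set w | forall i, ~ Y \subset S i w].
(* Membership in the full index set is inserted to match the form of [mutually_independent]. *)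
have missedE Y : missed Y =
    [set w | forall i, i \in [set: 'I_M]%SET ->
      [set B : {set X} | ~ Y \subset B] (S i w)].
  by apply/seteqP; split=> w /= h i; [move=> _|]; apply: h; rewrite ?inE.
have mmissed Y : measurable (missed Y).
  rewrite (_ : missed Y =
      \bigcap_(i in [set: 'I_M]) (S i @^-1` [set B : {set X} | ~ Y \subset B])).
    by apply: fin_bigcap_measurable => [|i _];
      [exact: finite_finset | exact: hmeas].
  by apply/seteqP; split=> w /= h i; [move=> _|]; apply: h.
have le_missed (Y : {set X}) : #|Y| == p -> (P (missed Y) <= ((1 - r) ^+ M)%:E)%E.
  move=> /eqP cY; rewrite missedE.
  rewrite (hindep [set: 'I_M]%SET (fun=> [set B : {set X} | ~ Y \subset B])).
  have q_ge : r <= 'C(n - p, k - p)%:R / 'C(n, k)%:R by exact: bin_ratio_ge.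
  set q := _ / _ in q_ge.
  have missE i : P [set w | ~ Y \subset S i w] = (1 - q)%:E.
    rewrite (_ : [set w | ~ Y \subset S i w] = ~` [set w | Y \subset S i w]) //.
    rewrite probability_setC; last exact: (hmeas i [set B : {set X} | Y \subset B]).
    by rewrite (probability_supset_uniform (hmeas i) (hunif i)) ?cY // hX.
  (* Raising [1 - q <= 1 - r] to the power [M] needs nonnegative bases; [1 - q] is a probability, as
     seen from the index [0], which exists because [1 <= M]. *)
  have q_le1 : 0 <= 1 - q.
    by rewrite -lee_fin -(missE (Ordinal hM)).
  under eq_bigr do rewrite missE.
  rewrite prodEFin lee_fin prodr_const cardsT card_ord lerXn2r ?nnegrE //; lra.
have mcov : measurable (covers_p_subsets p S) by exact: measurable_covers_p_subsets.
have sub : ~` covers_p_subsets p S `<=`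
    \big[setU/set0]_(Y : {set X} | #|Y| == p) missed Y.
  move=> w /= /existsNP[Y /not_implyP[/eqP cY /forallNP nY]].
  by rewrite (bigD1 Y) //=; left.
rewrite -[covers_p_subsets p S]setCK probability_setC; last exact: measurableC.
rewrite EFinB; apply: leeB => //.
apply: le_trans (le_measure _ _ _ sub) _; rewrite ?inE.
- exact: measurableC.
- exact: bigsetU_measurable.
apply: le_trans (probability_bigsetU_le _ _ mmissed) _.
apply: le_trans (lee_sum _ le_missed) _.
(* The constant bound is summed once per [p]-subset of [X], which gives the factor ['C(n, p)]. *)
rewrite sumEFin sumr_const lee_fin mulr_natl -hX -[#|X|]cardsT -cards_draws.
rewrite (@eq_card _ _
    [set A : {set X} | A \subset [set: X] & #|A| == p]%SET) // => A.
by rewrite inE finset.subsetT.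
Qed.
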